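(* Let $V_\lambda$ be an irreducible representation of $\mathfrak g$ and let $B=B^{\mathfrak g}$, $K=K^{\mathfrak g}$. Let $p_0(B),\dots,p_k(B)\in\mathfrak W(V_\lambda)$ be the sequence of polynomials in $B$ obtained by applying the Gram–Schmidt orthonormalization procedure to the powers $\mathbf 1,B,B^2,\dots,B^k$ of the conformal weight operator $B$. If all of $p_0(B),\dots,p_k(B)$ are $\tau$-eigenvectors and $p_k(B)$ is moreover a $K$-eigenvector, then the orthogonal projection $p_{k+1}(B)$ of $B^{k+1}$ onto the orthogonal complement of $\mathrm{span}\{\mathbf 1,B,\dots,B^k\}$ is again a $\tau$-eigenvector.
   Context: Setting: $\mathfrak g_{\mathbb R}\subset\mathfrak{so}(T_{\mathbb R})$ is an irreducible non-symmetric Riemannian holonomy algebra with its holonomy representation $T_{\mathbb R}$, i.e. one of $\mathfrak{so}_n$ on $\mathbb R^n$, $\mathfrak u_n$ or $\mathfrak{su}_n$ on $\mathbb C^n$, $\mathfrak{sp}(1)\oplus\mathfrak{sp}(n)$ on $\mathbb H^n$, $\mathfrak{sp}(n)$ on $\mathbb H^n$, $\mathfrak g_2$ on $\mathbb R^7$, $\mathfrak{spin}_7$ on the spinor representation $\mathbb R^8$ (the result is used for $\mathfrak{so}_n$, $\mathfrak g_2$, $\mathfrak{spin}_7$). $T=T_{\mathbb R}\otimes\mathbb C$ carries the $\mathbb C$-bilinear extension $\langle\cdot,\cdot\rangle$ of the scalar product; $\mathfrak g=\mathfrak g_{\mathbb R}\otimes\mathbb C$. $\Lambda^2T$ carries the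 scalar product given by Gram's determinant and $\mathfrak{so}(T)\cong\Lambda^2T$ via $\langle X,a\wedge b\rangle=\langle Xa,b\rangle$, so that the induced scalar product is $\langle X,Y\rangle=-\frac12\mathrm{tr}_T(XY)$. $\{X_\alpha\}$ is an orthonormal basis of $\mathfrak g\subset\Lambda^2T$. $\mathfrak W(V)=\mathrm{Hom}_{\mathfrak g}(T\otimes T,\mathrm{End}\,V)=\mathrm{End}_{\mathfrak g}(T\otimes V)$, where $F(b\otimes v)=\sum_\mu t_\mu\otimes F_{t_\mu\otimes b}v$ for an orthonormal basis $\{t_\mu\}$ of $T$; powers of $B$ are taken in the algebra $\mathrm{End}_{\mathfrak g}(T\otimes V)$ with unit $\mathbf 1=\mathrm{id}_{T\otimes V}$. The scalar product on $\mathfrak W(V)$ is $\langle F,\tilde F\rangle=\frac1{\dim V}\mathrm{tr}_{T\otimes V}(F\tilde F)$. The twist is $\tau(F)_{a\otimes b}=F_{b\otimes a}$. The conformal weight operator is $B=-\sum_\alpha X_\alpha\otimes X_\alpha\in\mathrm{End}_{\mathfrak g}(T\otimes V)$ (diagonalizable with real eigenvalues), and the classifying endomorphism is $K(F)_{a\otimes b}=-\sum_\alpha F_{X_\alpha a\otimes X_\alpha b}$. ''$\tau$-eigenvector'' means an element $F$ with $\tau(F)=F$ or $\tau(F)=-F$ (possibly zero, if $B^{k+1}$ already lies in the span). *)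

(* Defs.v *)
From HB Require Import structures.
From mathcomp Require Import all_boot all_order all_algebra.
From mathcomp Require Import complex mxtens.
From mathcomp Require Import reals.

Set Implicit Arguments.
Unset Strict Implicit.
Unset Printing Implicit Defensive.

Import Order.TTheory GRing.Theory Num.Theory.
Local Open Scope ring_scope.

Definition irreducible_on (F : fieldType) (n : nat) (S : 'M[F]_n -> Prop) :
    Prop :=
  (0 < n)%N /\
  forall U : {vspace 'cV[F]_n},
    (forall (A : 'M[F]_n) (v : 'cV[F]_n), S A -> v \in U -> A *m v \in U) ->
    U = 0%VS \/ U = fullv.

(** * Riemannian holonomy algebras

    [T_R] is [R^n] with its standard scalar product.  The model spaces [C^q],
    [H^q] are given by skew-symmetric complex structures on [R^n], so that [n]
    is forced to be [2 q], [4 q], and every orthogonal change of coordinates of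
    the standard representations is allowed. *)

Section Holonomy.
Variables (R : realType) (n : nat).

Definition skew_mx (A : 'M[R]_n) : Prop := A^T = - A.

Definition complex_structure (J : 'M[R]_n) : Prop :=
  skew_mx J /\ J *m J = - 1%:M.

Definition quaternionic_structure (I J : 'M[R]_n) : Prop :=
  [/\ complex_structure I, complex_structure J & I *m J = - (J *m I)].

Definition dotv (x y : 'cV[R]_n) : R := \sum_i x i 0 * y i 0.

(** [L x *m y] is the product [x * y]; on [R^7] such a product is the
    multiplication of imaginary octonions, up to an isometry. *)
Definition cross_product (L : {linear 'cV[R]_n -> 'M[R]_n}) : Prop :=
  forall x y : 'cV[R]_n,
    [/\ dotv (L x *m y) x = 0, dotv (L x *m y) y = 0 &
        dotv (L x *m y) (L x *m y)
        = dotv x x * dotv y y - dotv x y ^+ 2].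

(** Skew generators of a Clifford module structure over [R^7]. *)
Definition clifford_generators (c : 'I_7 -> 'M[R]_n) : Prop :=
  (forall i, skew_mx (c i)) /\
  (forall i j, c i *m c j + c j *m c i = - ((i == j)%:R *+ 2)%:M).

Inductive holonomy_list (gR : {vspace 'M[R]_n}) : Prop :=
| Hol_so of
    (forall X, X \in gR <-> skew_mx X)
| Hol_u (J : 'M[R]_n) of
    complex_structure J &
    (forall X, X \in gR <-> skew_mx X /\ X *m J = J *m X)
  (* [\tr (J *m X)] is, up to a factor, the imaginary part of the complex trace
     of [X], whose real part vanishes because [X] is skew *)
| Hol_su (J : 'M[R]_n) of
    complex_structure J &
    (forall X, X \in gR <->
       [/\ skew_mx X, X *m J = J *m X & \tr (J *m X) = 0])
| Hol_sp (I J : 'M[R]_n) of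
    quaternionic_structure I J &
    (forall X, X \in gR <->
       [/\ skew_mx X, X *m I = I *m X & X *m J = J *m X])
| Hol_sp1_sp (I J : 'M[R]_n) of
    quaternionic_structure I J &
    (forall X, X \in gR <->
       exists Y : 'M[R]_n, exists a b c : R,
         [/\ skew_mx Y, Y *m I = I *m Y, Y *m J = J *m Y &
             X = Y + (a *: I + b *: J + c *: (I *m J))])
| Hol_g2 (L : {linear 'cV[R]_n -> 'M[R]_n}) of
    n = 7%N & cross_product L &
    (forall X, X \in gR <->
       skew_mx X /\
       forall x y : 'cV[R]_n,
         X *m (L x *m y) = L (X *m x) *m y + L x *m (X *m y))
| Hol_spin7 (c : 'I_7 -> 'M[R]_n) of
    n = 8%N & clifford_generators c &
    gR = (\sum_(i < 7) \sum_(j < 7 | (i < j)%N) <[c i *m c j]>)%VS.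

(** Irreducibility rules out the degenerate members of the families, such as
    [su_1]. *)
Definition holonomy_algebra (gR : {vspace 'M[R]_n}) : Prop :=
  irreducible_on (fun X => X \in gR) /\ holonomy_list gR.

Definition complexification (gR : {vspace 'M[R]_n}) : {vspace 'M[R[i]]_n} :=
  <<[seq map_mx (real_complex R) X | X <- vbasis gR]>>%VS.

End Holonomy.

Section Representation.
Variables (C : fieldType) (n m : nat).

(** Only the values of [rho] on [g] are relevant. *)
Definition representation (g : {vspace 'M[C]_n}) (rho : 'M[C]_n -> 'M[C]_m) :
    Prop :=
  (forall (a : C) (X Y : 'M[C]_n), X \in g -> Y \in g ->
     rho (a *: X + Y) = a *: rho X + rho Y) /\
  (forall X Y : 'M[C]_n, X \in g -> Y \in g ->
     rho (X *m Y - Y *m X) = rho X *m rho Y - rho Y *m rho X).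

Definition irreducible_representation
    (g : {vspace 'M[C]_n}) (rho : 'M[C]_n -> 'M[C]_m) : Prop :=
  representation g rho /\
  irreducible_on (fun A : 'M[C]_m => exists2 X, X \in g & A = rho X).

Definition lambda2_dot (X Y : 'M[C]_n) : C := - 2%:R^-1 * \tr (X *m Y).

Definition orthonormal_basis (g : {vspace 'M[C]_n}) (Xs : seq 'M[C]_n) : Prop :=
  basis_of g Xs /\
  forall i j, (i < size Xs)%N -> (j < size Xs)%N ->
    lambda2_dot Xs`_i Xs`_j = (i == j)%:R.

End Representation.

(** * Weitzenböck formulas

    [T = C^n] with the bilinear form [<a, b> = a^T b], [V = C^m], and
    [End (T (x) V)] is ['M_(n * m)] via the Kronecker product [*t]. *)

Section Weitzenboeck.
Variables (C : numClosedFieldType) (n m : nat).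
Implicit Types (F P : 'M[C]_(n * m)) (rho : 'M[C]_n -> 'M[C]_m).

Definition weitzenboeck_space (g : {vspace 'M[C]_n}) rho F : Prop :=
  forall X : 'M[C]_n, X \in g ->
    let XTV : 'M[C]_(n * m) := X *t 1%:M + 1%:M *t rho X in
    XTV *m F = F *m XTV.

Definition stdvec (mu : 'I_n) : 'cV[C]_n := delta_mx mu 0.

(** [wcoef F a b] is [F_(a (x) b)]. *)
Definition wcoef F (a b : 'cV[C]_n) : 'M[C]_m :=
  \matrix_(i, j) \sum_mu \sum_nu
     a mu 0 * b nu 0 * F (mxtens_index (mu, i)) (mxtens_index (nu, j)).

(** The element [F] with [F_(t_mu (x) t_nu) = f t_mu t_nu], that is
    [F (t_nu (x) v) = \sum_mu t_mu (x) f t_mu t_nu v]. *)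
Definition of_wcoef (f : 'cV[C]_n -> 'cV[C]_n -> 'M[C]_m) : 'M[C]_(n * m) :=
  \sum_mu \sum_nu delta_mx mu nu *t f (stdvec mu) (stdvec nu).

Definition wdot F P : C := m%:R^-1 * \tr (F *m P).

Definition twist F : 'M[C]_(n * m) := of_wcoef (fun a b => wcoef F b a).

Definition classifying_endo (Xs : seq 'M[C]_n) F : 'M[C]_(n * m) :=
  of_wcoef (fun a b => - \sum_(X <- Xs) wcoef F (X *m a) (X *m b)).

Definition conformal_weight (Xs : seq 'M[C]_n) rho : 'M[C]_(n * m) :=
  - \sum_(X <- Xs) X *t rho X.

Definition twist_eigenvector F : Prop := twist F = F \/ twist F = - F.

Definition classifying_eigenvector (Xs : seq 'M[C]_n) F : Prop :=
  exists kappa : C, classifying_endo Xs F = kappa *: F.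

(** [p 0, ..., p k] is the result of the Gram-Schmidt procedure for the powers
    [B ^+ 0, ..., B ^+ k]; a power which depends on the preceding ones yields
    [0].  The form [wdot] is bilinear over [C], so normalization needs
    [wdot q q != 0].  When [B] is diagonalizable with real eigenvalues this is
    automatic for [q != 0]: [q] is then a real polynomial in [B] and
    [0 < wdot q q]. *)
Definition gram_schmidt (B : 'M[C]_(n * m)) (k : nat)
    (p : nat -> 'M[C]_(n * m)) : Prop :=
  forall j, (j <= k)%N ->
    let q := B ^+ j - \sum_(i < j) wdot (B ^+ j) (p i) *: p i in
    if q == 0 then p j = 0
    else wdot q q != 0 /\ p j = (sqrtC (wdot q q))^-1 *: q.

Definition powers_span (B : 'M[C]_(n * m)) (k : nat) :
    {vspace 'M[C]_(n * m)} :=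
  <<[seq B ^+ i | i <- iota 0 k.+1]>>%VS.

(** [P] is the orthogonal projection of [F] onto the orthogonal complement of
    [U] in the space of Weitzenböck formulas. *)
Definition orthogonal_projection_compl (g : {vspace 'M[C]_n}) rho
    (U : {vspace 'M[C]_(n * m)}) F P : Prop :=
  [/\ weitzenboeck_space g rho P,
      forall Q, Q \in U -> wdot P Q = 0 &
      F - P \in U].

End Weitzenboeck.

(* Main.v *)
Require Import Defs.
From HB Require Import structures.
From mathcomp Require Import all_boot all_order all_algebra.
From mathcomp Require Import sesquilinear spectral ring lra complex mxtens.
From mathcomp Require Import reals.

Set Implicit Arguments.
Unset Strict Implicit.
Unset Printing Implicit Defensive.

Import Order.TTheory GRing.Theory Num.Theory.
Local Open Scope ring_scope.

(** Everything rests on one identity between the classifying endomorphism [K],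
    the twist [tau] and the conformal weight operator [B].  For [X] in [g] put
    [x = X (x) 1] and [r = 1 (x) rho X], so that [B = - sum x r].  Then, for every
    Weitzenboeck formula [F],

      [K F = - B F - tau (tau F B) - c F],   where [sum X^2 = - c] on [T]

    ([classifying_endo_conformal_weight]).  Indeed [K F = sum x F x] because [X]
    is skew; the twist is the partial transposition of the factor [T], hence
    [tau (tau F B) = sum x F r]; and equivariance, [(x + r) F = F (x + r)], gives
    [x F x = x x F + x r F - x F r].

    Apply it to [F = p_k], with [tau F = eps F] and [K F = kappa F].  A polynomial
    in [B] commutes with [B], so the identity becomes
    [eps tau (B F) = - B F - (kappa + c) F], and [F' = B F + (kappa + c)/2 F]
    satisfies [tau F' = - eps F'] ([twist_conformal_weight_mul]).  Up to a factor,
    [F'] agrees with [B^(k+1)] modulo the span of [1, ..., B^k], so the required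
    projection is obtained from it by removing its components along the [p_i].
    The twist preserves the scalar product, so [F'] is orthogonal to the [p_i]
    with the opposite [tau]-eigenvalue; only components with the eigenvalue of
    [F'] are removed, and the result is a [tau]-eigenvector
    ([project_off_twist]).

    Two facts on [g] enter.  The Casimir tensor [sum X (x) X] is [g]-invariant,
    which needs [g] to be skew and closed under brackets; this is read off from
    each entry of the holonomy list.  The Casimir operator [sum X^2] is a scalar
    on [T] even when [T] splits over the complex numbers: its real and imaginary
    parts are symmetric real matrices commuting with [gR], and such a matrix has
    a real eigenvalue, whose eigenspace is everything by irreducibility
    ([complex_symmetric_schur]). *)

Lemma span_lin_ind (F : fieldType) (vT : vectType F) (s : seq vT)
    (K : vT -> Prop) :
  K 0 -> (forall a u v, K u -> K v -> K (a *: u + v)) ->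
  (forall u, u \in s -> K u) ->
  forall u, u \in <<s>>%VS -> K u.
Proof.
move=> K0 Klin Ks u span_u; rewrite (@coord_span _ _ _ (in_tuple s) u span_u).
apply: big_rec => // l v _ Kv; apply: Klin => //.
by apply: Ks; apply: mem_nth.
Qed.

(** * The twist and the scalar product in block coordinates *)

Section TensorBlocks.
Variables (C : numClosedFieldType) (n m : nat).
Implicit Types F G : 'M[C]_(n * m).

Lemma eq_tens_mx F G :
  (forall mu i nu j, F (mxtens_index (mu, i)) (mxtens_index (nu, j)) =
                     G (mxtens_index (mu, i)) (mxtens_index (nu, j))) ->
  F = G.
Proof.
move=> eqFG; apply/matrixP=> a b.
by case: (mxtens_indexP a) => mu i; case: (mxtens_indexP b) => nu j.
Qed.

Lemma sum_mxtens_index (f : 'I_(n * m) -> C) :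
  \sum_a f a = \sum_mu \sum_i f (mxtens_index (mu, i)).
Proof.
rewrite pair_big (reindex (@mxtens_index n m)) /=.
  by apply: eq_bigr => -[].
exists (@mxtens_unindex n m) => a _; first exact: mxtens_indexK.
exact: mxtens_unindexK.
Qed.

Lemma of_wcoefE (f : 'cV[C]_n -> 'cV[C]_n -> 'M[C]_m) mu i nu j :
  of_wcoef f (mxtens_index (mu, i)) (mxtens_index (nu, j)) =
  f (stdvec C mu) (stdvec C nu) i j.
Proof.
rewrite /of_wcoef summxE (bigD1 mu) //= [X in _ + X]big1 ?addr0 => [|mu' ne_mu].
  rewrite summxE (bigD1 nu) //= [X in _ + X]big1 ?addr0 => [|nu' ne_nu].
    by rewrite tensmxE mxE !eqxx mul1r.
  by rewrite tensmxE mxE (eq_sym nu) (negPf ne_nu) andbF mul0r.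
rewrite summxE big1 // => nu' _.
by rewrite tensmxE mxE (eq_sym mu) (negPf ne_mu) mul0r.
Qed.

Lemma wcoef_mulE F (X : 'M[C]_n) mu nu i j :
  wcoef F (X *m stdvec C mu) (X *m stdvec C nu) i j =
  \sum_kappa \sum_lambda X kappa mu * X lambda nu *
    F (mxtens_index (kappa, i)) (mxtens_index (lambda, j)).
Proof.
by rewrite mxE; do 2!apply: eq_bigr => ? _; rewrite -!colE !mxE.
Qed.

(** The twist is the partial transposition of the factor [T]. *)
Lemma twistE F mu i nu j :
  twist F (mxtens_index (mu, i)) (mxtens_index (nu, j)) =
  F (mxtens_index (nu, i)) (mxtens_index (mu, j)).
Proof.
rewrite of_wcoefE mxE (bigD1 nu) //= [X in _ + X]big1 ?addr0 => [|kappa ne_k].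
  rewrite (bigD1 mu) //= [X in _ + X]big1 ?addr0 => [|kappa ne_k].
    by rewrite !mxE !eqxx !mul1r.
  by rewrite !mxE (negPf ne_k) mulr0 mul0r.
by rewrite big1 // => lambda _; rewrite !mxE (negPf ne_k) !mul0r.
Qed.

Lemma tensDl (X Y : 'M[C]_n) (Z : 'M[C]_m) : (X + Y) *t Z = X *t Z + Y *t Z.
Proof. by apply: eq_tens_mx => *; rewrite !(tensmxE, mxE) mulrDl. Qed.

Lemma tensDr (X : 'M[C]_n) (Y Z : 'M[C]_m) : X *t (Y + Z) = X *t Y + X *t Z.
Proof. by apply: eq_tens_mx => *; rewrite !(tensmxE, mxE) mulrDr. Qed.

Lemma tensZl a (X : 'M[C]_n) (Z : 'M[C]_m) : (a *: X) *t Z = a *: (X *t Z).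
Proof. by apply: eq_tens_mx => *; rewrite !(tensmxE, mxE) mulrA. Qed.

Lemma tensZr a (X : 'M[C]_n) (Z : 'M[C]_m) : X *t (a *: Z) = a *: (X *t Z).
Proof. by apply: eq_tens_mx => *; rewrite !(tensmxE, mxE) mulrCA. Qed.

Lemma tensNl (X : 'M[C]_n) (Z : 'M[C]_m) : (- X) *t Z = - (X *t Z).
Proof. by rewrite -scaleN1r tensZl scaleN1r. Qed.

Lemma tensNr (X : 'M[C]_n) (Z : 'M[C]_m) : X *t (- Z) = - (X *t Z).
Proof. by rewrite -scaleN1r tensZr scaleN1r. Qed.

Lemma tens1mx1 : 1%:M *t 1%:M = 1%:M :> 'M[C]_(n * m).
Proof.
apply: eq_tens_mx => mu i nu j; rewrite tensmxE !mxE -natrM mulnb.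
by rewrite (can_eq (@mxtens_indexK n m)).
Qed.

Lemma twist_is_linear : linear (@twist C n m).
Proof. by move=> a F G; apply: eq_tens_mx => mu i nu j; rewrite !(twistE, mxE). Qed.

HB.instance Definition _ :=
  GRing.isLinear.Build C 'M[C]_(n * m) 'M[C]_(n * m) _ (@twist C n m)
    twist_is_linear.

Lemma twistK : involutive (@twist C n m).
Proof. by move=> F; apply: eq_tens_mx => mu i nu j; rewrite !twistE. Qed.

Lemma mul_tens1rE (A : 'M[C]_m) F mu i nu j :
  (F *m (1%:M *t A)) (mxtens_index (mu, i)) (mxtens_index (nu, j)) =
  \sum_l F (mxtens_index (mu, i)) (mxtens_index (nu, l)) * A l j.
Proof.
rewrite mxE sum_mxtens_index (bigD1 nu) //= [X in _ + X]big1 ?addr0.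
  by apply: eq_bigr => l _; rewrite tensmxE mxE eqxx mul1r.
move=> kappa ne_k; rewrite big1 // => l _.
by rewrite tensmxE mxE (negPf ne_k) mul0r mulr0.
Qed.

Lemma tensl1_mulE (X : 'M[C]_n) F mu i nu j :
  ((X *t 1%:M) *m F) (mxtens_index (mu, i)) (mxtens_index (nu, j)) =
  \sum_kappa X mu kappa * F (mxtens_index (kappa, i)) (mxtens_index (nu, j)).
Proof.
rewrite mxE sum_mxtens_index; apply: eq_bigr => kappa _.
rewrite (bigD1 i) //= [X in _ + X]big1 ?addr0 => [|l ne_l].
  by rewrite tensmxE mxE eqxx mulr1.
by rewrite tensmxE mxE eq_sym (negPf ne_l) mulr0 mul0r.
Qed.

Lemma mul_tensl1E (X : 'M[C]_n) F mu i nu j :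
  (F *m (X *t 1%:M)) (mxtens_index (mu, i)) (mxtens_index (nu, j)) =
  \sum_kappa F (mxtens_index (mu, i)) (mxtens_index (kappa, j)) * X kappa nu.
Proof.
rewrite mxE sum_mxtens_index; apply: eq_bigr => kappa _.
rewrite (bigD1 j) //= [X in _ + X]big1 ?addr0 => [|l ne_l].
  by rewrite tensmxE mxE eqxx mulr1.
by rewrite tensmxE mxE (negPf ne_l) !mulr0.
Qed.

(** Operators on [V] pass through the partial transposition, while operators on
    [T] are transposed and change sides ([twist_mul_tensl1]). *)
Lemma twist_mul_tens1r F (A : 'M[C]_m) :
  twist (F *m (1%:M *t A)) = twist F *m (1%:M *t A).
Proof.
apply: eq_tens_mx => mu i nu j; rewrite twistE !mul_tens1rE.
by apply: eq_bigr => l _; rewrite twistE.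
Qed.

Lemma twist_mul_tensl1 F (X : 'M[C]_n) :
  twist (F *m (X *t 1%:M)) = (X^T *t 1%:M) *m twist F.
Proof.
apply: eq_tens_mx => mu i nu j; rewrite twistE mul_tensl1E tensl1_mulE.
by apply: eq_bigr => l _; rewrite twistE mxE mulrC.
Qed.

Lemma wdotE F G :
  wdot F G = m%:R^-1 * \sum_mu \sum_i \sum_nu \sum_j
    F (mxtens_index (mu, i)) (mxtens_index (nu, j)) *
    G (mxtens_index (nu, j)) (mxtens_index (mu, i)).
Proof.
rewrite /wdot /mxtrace sum_mxtens_index; congr (_ * _).
by do 2!apply: eq_bigr => ? _; rewrite mxE sum_mxtens_index.
Qed.

(** The trace of a product pairs the block [(mu, nu)] of one factor with the
    block [(nu, mu)] of the other, and both are exchanged by the twist. *)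
Lemma wdot_twist F G : wdot (twist F) (twist G) = wdot F G.
Proof.
rewrite !wdotE; congr (_ * _).
have exch f : \sum_(mu < n) \sum_(i < m) \sum_(nu < n) \sum_(j < m) f mu i nu j =
    \sum_(mu < n) \sum_(nu < n) \sum_(i < m) \sum_(j < m) f mu i nu j :> C.
  by apply: eq_bigr => mu _; rewrite exchange_big.
rewrite !exch exchange_big /=; do 4!apply: eq_bigr => ? _.
by rewrite !twistE.
Qed.

Lemma wdotC F G : wdot F G = wdot G F.
Proof. by rewrite /wdot mxtrace_mulC. Qed.

Lemma wdotDl F G P : wdot (F + G) P = wdot F P + wdot G P.
Proof. by rewrite /wdot mulmxDl mxtraceD mulrDr. Qed.

Lemma wdotZl a F P : wdot (a *: F) P = a * wdot F P.
Proof. by rewrite /wdot -scalemxAl mxtraceZ mulrCA. Qed.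

Lemma wdot_suml (I : Type) (r : seq I) (Pr : pred I) (f : I -> 'M[C]_(n * m)) P :
  wdot (\sum_(i <- r | Pr i) f i) P = \sum_(i <- r | Pr i) wdot (f i) P.
Proof.
apply: (big_morph (fun F => wdot F P)) => [F G|]; first exact: wdotDl.
by rewrite /wdot mul0mx mxtrace0 mulr0.
Qed.

Lemma twist_eigenvectorP F :
  twist_eigenvector F <-> exists b : bool, twist F = (-1) ^+ b *: F.
Proof.
rewrite /twist_eigenvector; split=> [[->|->]|[[|] ->]].
- by exists false; rewrite scale1r.
- by exists true; rewrite scaleN1r.
- by right; rewrite scaleN1r.
- by left; rewrite scale1r.
Qed.

(** The twist is an isometry of the scalar product, so that [wdot F G] equals its
    own opposite. *)
Lemma twist_eigenvector_ortho (a b : bool) F G :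
  twist F = (-1) ^+ a *: F -> twist G = (-1) ^+ b *: G ->
  a != b -> wdot F G = 0.
Proof.
move=> tF tG ne_ab; have := wdot_twist F G.
rewrite tF tG wdotZl wdotC wdotZl wdotC mulrA -signr_addb addbC addbC.
have -> : a (+) b by case: a b ne_ab {tF tG} => -[].
rewrite mulN1r => /eqP; rewrite eq_sym -addr_eq0 -mulr2n mulrn_eq0 /=.
by move/eqP.
Qed.

(** The indices contracted with [X] on the left form [X^T], and [X^T = - X]
    absorbs the sign in the definition of [K]. *)
Lemma classifying_endoE (Xs : seq 'M[C]_n) F :
  (forall X, X \in Xs -> X^T = - X) ->
  classifying_endo Xs F =
    \sum_(X <- Xs) (X *t 1%:M) *m F *m (X *t 1%:M).
Proof.
move=> skXs; apply: eq_tens_mx => mu i nu j.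
rewrite of_wcoefE mxE !summxE -sumrN. apply: eq_big_seq => X /skXs skX.
rewrite wcoef_mulE mul_tensl1E exchange_big /= -sumrN.
apply: eq_bigr => lambda _; rewrite tensl1_mulE mulr_suml -sumrN.
apply: eq_bigr => kappa _.
have -> : X mu kappa = - X kappa mu.
  by have := congr1 (fun Y : 'M__ => Y kappa mu) skX; rewrite !mxE.
by rewrite !mulNr mulrAC.
Qed.

End TensorBlocks.

(** * Invariance of the Casimir tensor *)

Section Casimir.
Variables (C : fieldType) (n : nat) (g : {vspace 'M[C]_n}) (Xs : seq 'M[C]_n).
Hypothesis onb : orthonormal_basis g Xs.

Lemma mem_orthonormal_basis i : (i < size Xs)%N -> Xs`_i \in g.
Proof. by case: onb => bg _ lti; apply: (basis_mem bg); apply: mem_nth. Qed.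

Lemma lambda2_dotC (X Y : 'M[C]_n) : lambda2_dot X Y = lambda2_dot Y X.
Proof. by rewrite /lambda2_dot mxtrace_mulC. Qed.

(** The adjoint action is skew for the trace form. *)
Lemma lambda2_dot_bracket (X Y Z : 'M[C]_n) :
  lambda2_dot (Y *m X - X *m Y) Z = - lambda2_dot X (Y *m Z - Z *m Y).
Proof.
rewrite /lambda2_dot -[RHS]mulrN; congr (_ * _).
have trB A B : \tr (A - B) = \tr A - \tr B by exact: raddfB.
by rewrite mulmxBl mulmxBr !trB -mulmxA mxtrace_mulC opprB !mulmxA.
Qed.

Lemma orthonormal_expansion Y : Y \in g ->
  Y = \sum_(i < size Xs) lambda2_dot Y Xs`_i *: Xs`_i.
Proof.
case: onb => bg orth gY.
have [c defY] : exists c : 'I_(size Xs) -> C, Y = \sum_i c i *: Xs`_i.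
  exists (coord (in_tuple Xs) ^~ Y); apply: (@coord_span _ _ _ (in_tuple Xs)).
  by rewrite (span_basis bg).
rewrite {1}defY; apply: eq_bigr => i _; congr (_ *: _).
rewrite defY /lambda2_dot mulmx_suml raddf_sum mulr_sumr (bigD1 i) //=.
rewrite big1 ?addr0 => [|j ne_ji].
  rewrite -scalemxAl mxtraceZ mulrCA -/(lambda2_dot _ _) orth //.
  by rewrite eqxx mulr1.
rewrite -scalemxAl mxtraceZ mulrCA -/(lambda2_dot _ _) orth //.
by rewrite val_eqE (negPf ne_ji) mulr0.
Qed.

Lemma linear_on_expansion (W : lmodType C) (h : 'M[C]_n -> W) :
  (forall a X Y, X \in g -> Y \in g -> h (a *: X + Y) = a *: h X + h Y) ->
  forall Y, Y \in g -> h Y = \sum_(i < size Xs) lambda2_dot Y Xs`_i *: h Xs`_i.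
Proof.
move=> lin_h Y gY; rewrite {1}(orthonormal_expansion gY).
have h0 : h 0 = 0.
  apply: (addrI (h 0)); rewrite -{1}[h 0]scale1r -lin_h ?mem0v //.
  by rewrite scaler0 !addr0.
pose K X y := X \in g /\ h X = y.
suff [] : K (\sum_(i < size Xs) lambda2_dot Y Xs`_i *: Xs`_i)
            (\sum_(i < size Xs) lambda2_dot Y Xs`_i *: h Xs`_i) by [].
elim/big_ind2: _ => [|x X z Z [gX hX] [gZ hZ]|i _].
- by split; rewrite ?mem0v.
- split; first exact: memvD.
  by rewrite -[X]scale1r lin_h // hX hZ scale1r.
have gi := mem_orthonormal_basis (ltn_ord i).
split; first exact: memvZ.
by rewrite -[_ *: _]addr0 lin_h ?mem0v // h0 addr0.
Qed.

Hypothesis bracketg :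
  forall X Y, X \in g -> Y \in g -> X *m Y - Y *m X \in g.

(** In an orthonormal basis the operator [ad Y] has a skew-symmetric matrix, so
    the two halves of [ad Y (sum X (x) X)] cancel; [f] is any bilinear map on
    [g], evaluated on this tensor. *)
Lemma casimir_invariant (W : lmodType C) (f : 'M[C]_n -> 'M[C]_n -> W) :
  (forall a X Y Z, X \in g -> Y \in g -> Z \in g ->
     f (a *: X + Y) Z = a *: f X Z + f Y Z) ->
  (forall a X Y Z, X \in g -> Y \in g -> Z \in g ->
     f Z (a *: X + Y) = a *: f Z X + f Z Y) ->
  forall Y, Y \in g ->
  \sum_(X <- Xs) (f (Y *m X - X *m Y) X + f X (Y *m X - X *m Y)) = 0.
Proof.
move=> linl linr Y gY; rewrite (big_nth 0) big_mkord big_split /=.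
pose br i := Y *m Xs`_i - Xs`_i *m Y.
have gi (i : 'I_(size Xs)) := mem_orthonormal_basis (ltn_ord i).
have gbr (i : 'I_(size Xs)) : br i \in g by exact: (bracketg gY (gi i)).
transitivity
  (\sum_(i < size Xs) \sum_(j < size Xs) lambda2_dot (br i) Xs`_j *: f Xs`_j Xs`_i +
   \sum_(i < size Xs) \sum_(j < size Xs) lambda2_dot (br i) Xs`_j *: f Xs`_i Xs`_j).
  congr (_ + _); apply: eq_bigr => i _.
    apply: (linear_on_expansion (h := f ^~ Xs`_i)) (gbr i) => a X Z gX gZ.
    exact: linl.
  apply: (linear_on_expansion (h := f Xs`_i)) (gbr i) => a X Z gX gZ.
  exact: linr.
rewrite exchange_big -big_split big1 //= => i _; rewrite -big_split big1 //= => j _.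
by rewrite -scalerDl lambda2_dot_bracket lambda2_dotC addNr scale0r.
Qed.

Lemma casimir_commute Y : Y \in g ->
  Y *m (\sum_(X <- Xs) X *m X) = (\sum_(X <- Xs) X *m X) *m Y.
Proof.
move=> gY; apply/eqP; rewrite -subr_eq0 mulmx_sumr mulmx_suml -sumrB.
apply/eqP; rewrite -[RHS](casimir_invariant (f := @mulmx C n n n) _ _ gY).
- apply: eq_bigr => X _.
  by rewrite mulmxBl mulmxBr !mulmxA addrA subrK.
- by move=> a X X' Z *; rewrite mulmxDl -scalemxAl.
- by move=> a X X' Z *; rewrite mulmxDr -scalemxAr.
Qed.

End Casimir.

(** * The identity relating K, the twist and B *)

Section Commutation.
Variables (C : numClosedFieldType) (n m : nat) (g : {vspace 'M[C]_n}).
Variables (Xs : seq 'M[C]_n) (rho : 'M[C]_n -> 'M[C]_m).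
Hypothesis onb : orthonormal_basis g Xs.
Hypothesis bracketg :
  forall X Y, X \in g -> Y \in g -> X *m Y - Y *m X \in g.
Hypothesis rep : representation g rho.

(** [casimir_invariant] for the bilinear map [X, Z |-> X (x) rho Z]. *)
Lemma conformal_weight_equivariant :
  weitzenboeck_space g rho (conformal_weight Xs rho).
Proof.
case: rep => lin_rho br_rho Y gY /=; rewrite /conformal_weight.
rewrite mulmxN mulNmx; congr (- _); apply/eqP; rewrite -subr_eq0.
rewrite mulmx_sumr mulmx_suml -sumrB; apply/eqP.
rewrite -[RHS](casimir_invariant onb bracketg
                 (f := fun X Z => X *t rho Z) _ _ gY).
- apply: eq_big_seq => X /(basis_mem (proj1 onb)) gX.
  rewrite br_rho // mulmxDl mulmxDr !tensmx_mul !mul1mx !mulmx1.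
  by rewrite !(tensDl, tensDr) tensNl tensNr opprD addrACA.
- by move=> a X X' Z *; rewrite tensDl tensZl.
- by move=> a X X' Z gX gX' gZ; rewrite lin_rho // tensDr tensZr.
Qed.

(** The identity behind the theorem: equivariance of [F] moves one factor [X (x) 1]
    from the left of [F] to the right, which turns [B F] into the three terms. *)
Lemma classifying_endo_conformal_weight (c : C) F :
  (forall X, X \in g -> X^T = - X) ->
  \sum_(X <- Xs) X *m X = - c%:M ->
  weitzenboeck_space g rho F ->
  let B := conformal_weight Xs rho in
  classifying_endo Xs F = - (B *m F) - twist (twist F *m B) - c *: F.
Proof.
move=> skg cas eqF B.
have skXs X : X \in Xs -> X^T = - X by move/(basis_mem (proj1 onb))/skg.
rewrite classifying_endoE //.
have -> : twist (twist F *m B) =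
    \sum_(X <- Xs) (X *t 1%:M) *m F *m (1%:M *t rho X).
  rewrite /B /conformal_weight mulmxN mulmx_sumr (linearN (@twist C n m)).
  rewrite (linear_sum (@twist C n m)) -sumrN /=.
  apply: eq_big_seq => X /skXs skX.
  have -> : X *t rho X = (1%:M *t rho X) *m (X *t 1%:M).
    by rewrite tensmx_mul mul1mx mulmx1.
  rewrite mulmxA twist_mul_tensl1 twist_mul_tens1r twistK skX.
  by rewrite tensNl !mulNmx opprK mulmxA.
have -> : c *: F = - \sum_(X <- Xs) (X *t 1%:M) *m (X *t 1%:M) *m F.
  rewrite -mulmx_suml; under eq_bigr do rewrite tensmx_mul mul1mx.
  rewrite -(big_morph (fun Y : 'M_n => Y *t (1%:M : 'M_m))
             (fun Y Z => tensDl Y Z 1%:M) (tens0mx _)) cas.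
  rewrite tensNl mulNmx opprK -(scalemx1 _ c) tensZl tens1mx1.
  by rewrite -scalemxAl mul1mx.
rewrite /B /conformal_weight mulNmx !opprK mulmx_suml -sumrB -big_split /=.
apply: eq_big_seq => X /(basis_mem (proj1 onb)) gX.
have /= eqX := eqF X gX; rewrite mulmxDl mulmxDr in eqX.
have -> : X *t rho X = (X *t 1%:M) *m (1%:M *t rho X).
  by rewrite tensmx_mul mul1mx mulmx1.
have := congr1 (mulmx (X *t 1%:M)) eqX.
rewrite !mulmxDr !mulmxA => eqxX.
apply: (addIr (X *t 1%:M *m F *m (1%:M *t rho X))).
by rewrite -eqxX addrAC subrK addrC.
Qed.

End Commutation.

(** * Gram-Schmidt for the powers of an operator *)

Section GramSchmidt.
Variables (C : numClosedFieldType) (n m : nat) (B : 'M[C]_(n * m)) (k : nat).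
Variable p : nat -> 'M[C]_(n * m).
Hypothesis gs : gram_schmidt B k p.

Lemma mem_powers_span i j : (i <= j)%N -> B ^+ i \in powers_span B j.
Proof.
by move=> le_ij; apply: memv_span; apply: map_f; rewrite mem_iota add0n ltnS.
Qed.

Lemma powers_spanS i j : (i <= j)%N ->
  (powers_span B i <= powers_span B j)%VS.
Proof.
move=> le_ij; apply/span_subvP => F /mapP[l]; rewrite mem_iota add0n ltnS.
by move=> /andP[_ le_li] ->; apply: mem_powers_span (leq_trans le_li le_ij).
Qed.

Lemma powers_span_ind (K : 'M[C]_(n * m) -> Prop) j :
  (forall i, (i <= j)%N -> K (B ^+ i)) ->
  (forall a F G, K F -> K G -> K (a *: F + G)) ->
  forall F, F \in powers_span B j -> K F.
Proof.
move=> KB Klin; apply: span_lin_ind => //.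
  by rewrite -(subrr (B ^+ 0)) addrC -scaleN1r; apply: Klin; apply: KB.
move=> F /mapP[l]; rewrite mem_iota add0n ltnS => /andP[_ le_lj] ->.
exact: KB.
Qed.

(** Multiplication by [B] raises the filtration by powers by one step. *)
Lemma powers_span_mul j F :
  F \in powers_span B j -> B *m F \in powers_span B j.+1.
Proof.
apply: (@powers_span_ind (fun F => B *m F \in powers_span B j.+1)).
  by move=> i le_ij; rewrite mulmxE -exprS mem_powers_span.
by move=> a F' G BF BG; rewrite mulmxDr -scalemxAr memvD ?memvZ.
Qed.

Lemma powers_span_comm j F : F \in powers_span B j -> B *m F = F *m B.
Proof.
apply: (@powers_span_ind (fun F => B *m F = F *m B)) => [i _|a F' G BF BG].
  by rewrite !mulmxE -exprS -exprSr.
by rewrite mulmxDr mulmxDl -scalemxAr -scalemxAl BF BG.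
Qed.

Lemma gram_schmidt_expansion j : (j <= k)%N ->
  exists s, B ^+ j = s *: p j + \sum_(i < j) wdot (B ^+ j) (p i) *: p i.
Proof.
move=> /gs /=; case: eqP => [/eqP|_ [nz ->]].
  by rewrite subr_eq0 => /eqP {1}-> ->; exists 0; rewrite scaler0 add0r.
exists (sqrtC (wdot (B ^+ j - \sum_(i < j) wdot (B ^+ j) (p i) *: p i)
                    (B ^+ j - \sum_(i < j) wdot (B ^+ j) (p i) *: p i))).
by rewrite scalerA mulfV ?sqrtC_eq0 // scale1r subrK.
Qed.

Lemma gram_schmidt_scaled j : (j <= k)%N ->
  exists s, p j = s *: (B ^+ j - \sum_(i < j) wdot (B ^+ j) (p i) *: p i).
Proof.
move=> /gs /=; case: eqP => [_ ->|_ [_ ->]]; first by exists 0; rewrite scale0r.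
by exists (sqrtC (wdot (B ^+ j - \sum_(i < j) wdot (B ^+ j) (p i) *: p i)
                    (B ^+ j - \sum_(i < j) wdot (B ^+ j) (p i) *: p i)))^-1.
Qed.

Lemma gram_schmidt_mem j : (j <= k)%N -> p j \in powers_span B j.
Proof.
elim/ltn_ind: j => j IHj le_jk; have [s ->] := gram_schmidt_scaled le_jk.
rewrite memvZ // memvB ?mem_powers_span // memv_suml // => i _.
rewrite memvZ //; apply: subvP (powers_spanS (ltnW (ltn_ord i))) _ _.
by apply: IHj; rewrite // (leq_trans (ltnW (ltn_ord i))).
Qed.

(** Covers both outcomes of the procedure: [p j = 0], or [p j] has unit square. *)
Lemma gram_schmidt_unit j : (j <= k)%N -> wdot (p j) (p j) *: p j = p j.
Proof.
move=> /gs /=; case: eqP => [_ ->|_ [nz ->]]; first by rewrite scaler0.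
rewrite wdotZl wdotC wdotZl mulrA -invfM -expr2 sqrtCK.
by rewrite mulVf // scale1r.
Qed.

Lemma wdot_gram_schmidt_unit F j : (j <= k)%N ->
  wdot F (p j) * wdot (p j) (p j) = wdot F (p j).
Proof.
by move=> /gram_schmidt_unit pj; rewrite mulrC [wdot F _]wdotC -wdotZl pj.
Qed.

(** The form is bilinear over the complex numbers and could have isotropic
    vectors; the absorption rule [wdot_gram_schmidt_unit] is all that the usual
    inductive argument needs. *)
Lemma gram_schmidt_ortho i j :
  (i <= k)%N -> (j <= k)%N -> i != j -> wdot (p i) (p j) = 0.
Proof.
suff ortho j' : (j' <= k)%N -> forall i', (i' < j')%N -> wdot (p j') (p i') = 0.
  move=> le_ik le_jk; rewrite neq_ltn => /orP[lt_ij|lt_ji]; last exact: ortho.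
  by rewrite wdotC; apply: ortho.
elim/ltn_ind: j' => {i}j IHj le_jk i lt_ij.
have [s ->] := gram_schmidt_scaled le_jk.
have le_ik := leq_trans (ltnW lt_ij) le_jk.
rewrite wdotZl -scaleN1r wdotDl wdotZl wdot_suml (bigD1 (Ordinal lt_ij)) //=.
rewrite big1 ?addr0 => [|l ne_li].
  by rewrite wdotZl wdot_gram_schmidt_unit // mulN1r subrr mulr0.
rewrite wdotZl; have [eq_li|ne_li'] := eqVneq (l : nat) i.
  by rewrite -val_eqE /= eq_li eqxx in ne_li.
have [lt_li|le_il] := ltnP l i.
  by rewrite [wdot (p l) _]wdotC (IHj i lt_ij le_ik l lt_li) mulr0.
have le_lk := leq_trans (ltnW (ltn_ord l)) le_jk.
have lt_il: (i < l)%N by rewrite ltn_neqAle eq_sym ne_li'.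
by rewrite (IHj l (ltn_ord l) le_lk i lt_il) mulr0.
Qed.

Lemma powers_span_gram_schmidt F : F \in powers_span B k ->
  exists c : 'I_k.+1 -> C, F = \sum_i c i *: p i.
Proof.
apply: (@powers_span_ind (fun F => exists c : 'I_k.+1 -> C, F = \sum_i c i *: p i)).
  move=> j le_jk; have [s ->] := gram_schmidt_expansion le_jk.
  pose c (i : nat) :=
    if i == j then s else if (i < j)%N then wdot (B ^+ j) (p i) else 0.
  exists c.
  rewrite -[RHS](big_mkord xpredT (fun i => c i *: p i)) /=.
  have tail0 : \sum_(j.+1 <= i < k.+1) c i *: p i = 0.
    apply: big1_seq => i; rewrite mem_index_iota => /andP[_ /andP[lt_ji _]].
    by rewrite /c gtn_eqF // ltnNge ltnW // scale0r.
  have cj : c j = s by rewrite /c eqxx.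
  rewrite (big_cat_nat (n := j.+1)) //= tail0 addr0 big_nat_recr //= cj big_mkord.
  rewrite addrC; congr (_ + _).
  by apply: eq_bigr => i _; rewrite /c ltn_ord ltn_eqF.
move=> a F' G [c ->] [d ->]; exists (fun i => a * c i + d i).
rewrite scaler_sumr -big_split; apply: eq_bigr => i _.
by rewrite scalerDl scalerA.
Qed.

Definition project_off F := F - \sum_(i < k.+1) wdot F (p i) *: p i.

Lemma project_off_ortho F j : (j <= k)%N -> wdot (project_off F) (p j) = 0.
Proof.
move=> le_jk; rewrite /project_off -scaleN1r wdotDl wdotZl wdot_suml.
rewrite (bigD1 (Ordinal (le_jk : j < k.+1)%N)) //= big1 ?addr0 => [|i ne_ij].
  by rewrite wdotZl wdot_gram_schmidt_unit // mulN1r subrr.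
by rewrite wdotZl gram_schmidt_ortho ?mulr0 // -ltnS.
Qed.

(** This gives the uniqueness of the projection: the form is nondegenerate on the
    span because the nonzero [p i] form an orthonormal basis of it. *)
Lemma powers_span_nondegenerate F : F \in powers_span B k ->
  (forall j, (j <= k)%N -> wdot F (p j) = 0) -> F = 0.
Proof.
move=> /powers_span_gram_schmidt[c defF] Fp0; rewrite defF big1 // => i _.
have le_ik : (i <= k)%N by rewrite -ltnS.
suff cp0: c i * wdot (p i) (p i) = 0.
  by rewrite -(gram_schmidt_unit le_ik) scalerA cp0 scale0r.
rewrite -(Fp0 i) // defF wdot_suml (bigD1 i) //= big1 ?addr0 ?wdotZl // => j ne_ji.
by rewrite wdotZl gram_schmidt_ortho ?mulr0 // -ltnS.
Qed.

End GramSchmidt.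

(** * The twist eigenvector property of the projection *)

Section Projection.
Variables (C : numClosedFieldType) (n m : nat) (g : {vspace 'M[C]_n}).
Variables (Xs : seq 'M[C]_n) (rho : 'M[C]_n -> 'M[C]_m).
Variables (k : nat) (p : nat -> 'M[C]_(n * m)).
Hypothesis onb : orthonormal_basis g Xs.
Hypothesis bracketg :
  forall X Y, X \in g -> Y \in g -> X *m Y - Y *m X \in g.
Hypothesis skg : forall X, X \in g -> X^T = - X.
Variable c : C.
Hypothesis cas : \sum_(X <- Xs) X *m X = - c%:M.
Hypothesis rep : representation g rho.
Let B := conformal_weight Xs rho.
Hypothesis gs : gram_schmidt B k p.

Lemma powers_span_equivariant j F :
  F \in powers_span B j -> weitzenboeck_space g rho F.
Proof.
have eqB := conformal_weight_equivariant onb bracketg rep.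
apply: powers_span_ind => {F} [i _|a F G eqF eqG] X gX /=.
  apply: (@commrX _ (_ : 'M_(n * m))); exact: eqB.
have /= eqFX := eqF X gX; have /= eqGX := eqG X gX.
move: (_ + _) eqFX eqGX => Y eqFX eqGX.
by rewrite mulmxDr mulmxDl -scalemxAr -scalemxAl eqFX eqGX.
Qed.

Lemma unique_projection P :
  orthogonal_projection_compl g rho (powers_span B k) (B ^+ k.+1) P ->
  unique (orthogonal_projection_compl g rho (powers_span B k) (B ^+ k.+1)) P.
Proof.
move=> projP; split=> // P' [_ oP' sP']; case: projP => _ oP sP.
apply/eqP; rewrite -subr_eq0; apply/eqP.
apply: (powers_span_nondegenerate gs) => [|j le_jk].
  have -> : P - P' = (B ^+ k.+1 - P') - (B ^+ k.+1 - P).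
    by rewrite opprB [RHS]addrC addrA subrK.
  exact: memvB.
have pj : p j \in powers_span B k.
  exact: subvP (powers_spanS _ le_jk) _ (gram_schmidt_mem gs le_jk).
by rewrite -scaleN1r wdotDl wdotZl oP // oP' // mulr0 addr0.
Qed.

(** With [tau F = eps F] the identity expresses [eps tau (B F)] through [B F] and
    [F]; the shift by [(kappa + c) / 2] is the one which makes [B F] an
    eigenvector, for the opposite sign. *)
Lemma twist_conformal_weight_mul (b : bool) (kappa : C) F :
  F \in powers_span B k ->
  twist F = (-1) ^+ b *: F -> classifying_endo Xs F = kappa *: F ->
  let F' := B *m F + ((kappa + c) / 2%:R) *: F in
  twist F' = - (-1) ^+ b *: F'.
Proof.
move=> BF tF KF /=.
have eqF := powers_span_equivariant BF.
have /= := classifying_endo_conformal_weight onb skg cas eqF.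
rewrite -/B KF tF -scalemxAl -(powers_span_comm BF) linearZ /= => eqK.
have eqt : (-1) ^+ b *: twist (B *m F) = - (B *m F + (kappa + c) *: F).
  by rewrite scalerDl eqK subrK addrA subrr add0r opprK.
rewrite linearD linearZ /= tF.
have -> : twist (B *m F) = (-1) ^+ b *: - (B *m F + (kappa + c) *: F).
  by rewrite -eqt scalerA -signr_addb addbb scale1r.
set e := (kappa + c) / 2%:R; have -> : kappa + c = e + e by exact: splitr.
rewrite scaleNr -scalerN scalerA [e * _]mulrC -scalerA -scalerDr scalerDl.
by rewrite addrA opprD subrK.
Qed.

(** A component along [p i] is nonzero only if [p i] has the same sign as [F]. *)
Lemma project_off_twist (b : bool) F :
  (forall j, (j <= k)%N -> twist_eigenvector (p j)) ->
  twist F = (-1) ^+ b *: F ->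
  twist (project_off k p F) = (-1) ^+ b *: project_off k p F.
Proof.
move=> twp tF; rewrite /project_off (linearB (@twist C n m)).
rewrite (linear_sum (@twist C n m)) /= tF scalerBr.
congr (_ - _); rewrite scaler_sumr; apply: eq_bigr => i _.
have [b' tp] : exists b' : bool, twist (p i) = (-1) ^+ b' *: p i.
  by apply/twist_eigenvectorP/twp; rewrite -ltnS.
rewrite linearZ /=; have [<-|ne_b] := eqVneq b' b.
  by rewrite tp !scalerA mulrC.
by rewrite (twist_eigenvector_ortho tF tp) 1?eq_sym // !scale0r scaler0.
Qed.

Lemma projection_twist_eigenvector :
  (forall j, (j <= k)%N -> twist_eigenvector (p j)) ->
  classifying_eigenvector Xs (p k) ->
  exists P : 'M[C]_(n * m),
    unique (orthogonal_projection_compl g rho (powers_span B k) (B ^+ k.+1)) P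
    /\ twist_eigenvector P.
Proof.
move=> twp [kappa Kp]; have [b tpk] := (twist_eigenvectorP _).1 (twp k (leqnn k)).
have pmem j : (j <= k)%N -> p j \in powers_span B k.
  by move=> le_jk; apply: subvP (powers_spanS _ le_jk) _ (gram_schmidt_mem gs le_jk).
have tF' := twist_conformal_weight_mul (pmem k (leqnn k)) tpk Kp.
have [s defBk] := gram_schmidt_expansion gs (leqnn k).
set F' := B *m p k + _ in tF'.
have psumU F : \sum_(i < k.+1) wdot F (p i) *: p i \in powers_span B k.
  by apply: memv_suml => i _; rewrite memvZ // pmem // -ltnS.
(* Here [B ^+ k = s *: p k + ...]; for [p k = 0] the candidate [P] vanishes, as it
   should since [B ^+ k.+1] then lies in the span. *)
pose P := project_off k p (s *: F').
have BP : B ^+ k.+1 - P \in powers_span B k.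
  rewrite /P /project_off opprB addrCA memvD ?psumU // exprS defBk.
  rewrite -mulmxE mulmxDr -scalemxAr scalerDr opprD addrACA subrr add0r.
  rewrite memvB ?memvZ ?pmem // mulmx_sumr memv_suml // => i _.
  rewrite -scalemxAr memvZ //; apply: subvP (powers_spanS _ (ltn_ord i)) _ _.
  exact/powers_span_mul/(gram_schmidt_mem gs)/ltnW.
exists P; split.
  apply: unique_projection; split=> //.
    have -> : P = B ^+ k.+1 - (B ^+ k.+1 - P) by rewrite opprB addrC subrK.
    apply: (@powers_span_equivariant k.+1); apply: memvB.
      exact: mem_powers_span.
    exact: subvP (powers_spanS _ (leqnSn k)) _ BP.
  move=> Q /(powers_span_gram_schmidt gs)[d ->].
  rewrite wdotC wdot_suml big1 // => i _.
  by rewrite wdotZl wdotC (project_off_ortho gs) ?mulr0 // -ltnS.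
apply/twist_eigenvectorP; exists (~~ b); apply: project_off_twist => //.
by rewrite linearZ /= tF' scalerA mulrC -scalerA signrN.
Qed.

End Projection.

(** * Schur's lemma for symmetric operators *)

Section SymmetricSchur.
Variables (R : rcfType) (n : nat).

(** As a complex matrix [A] is hermitian, hence has a real eigenvalue; this is a
    root of the characteristic polynomial of [A] itself. *)
Lemma symmetric_real_eigenvalue (A : 'M[R]_n) :
  (0 < n)%N -> A^T = A -> exists a, eigenvalue A a.
Proof.
move=> n_gt0 symA; pose Ac := map_mx (real_complex R) A.
have hermA : Ac \is hermsymmx.
  apply: realsym_hermsym.
    apply/is_hermitianmxP; rewrite expr0 scale1r map_mx_id //.
    by rewrite /Ac map_trmx symA.
  by apply/mxOverP=> i j; rewrite mxE; apply/complex_realP; exists (A i j).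
have /mxOverP realD := hermitian_spectral_diag_real hermA.
have /complex_realP[a Da] := realD 0 (Ordinal n_gt0).
exists a; rewrite eigenvalue_root_char -(fmorph_root (real_complex R)).
rewrite map_char_poly -eigenvalue_root_char; apply/eigenvalueP.
pose P := spectralmx Ac; have uP : P \in unitmx := spectral_unit _.
exists (row (Ordinal n_gt0) P).
  have /hermitian_normalmx/orthomx_spectralP := hermA; rewrite -/P -/Ac => {1}->.
  rewrite -row_mul !mulmxA mulmxV // mul1mx row_mul row_diag_mx.
  by rewrite -scalemxAl -rowE Da.
apply: contraTneq uP => P0; apply/negP=> uP.
have := congr1 (mulmx^~ (invmx P)) P0.
rewrite -row_mul mulmxV // mul0mx => /rowP/(_ (Ordinal n_gt0))/eqP.
by rewrite !mxE eqxx oner_eq0.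
Qed.

(** Symmetry excludes the complex and quaternionic commutants that an irreducible
    real representation may have. *)
Lemma symmetric_schur (S : 'M[R]_n -> Prop) (A : 'M[R]_n) :
  irreducible_on S -> A^T = A -> (forall X, S X -> X *m A = A *m X) ->
  exists a, A = a%:M.
Proof.
case=> n_gt0 irr symA commA.
have [a /eigenvalueP[v vA nzv]] := symmetric_real_eigenvalue n_gt0 symA.
exists a; pose f := linfun (mulmx (A - a%:M) : 'cV[R]_n -> 'cV[R]_n).
have fE (u : 'cV[R]_n) : (u \in lker f) = (A *m u == a *: u).
  by rewrite memv_ker lfunE /= mulmxBl mul_scalar_mx subr_eq0.
case: (irr (lker f)) => [X u SX|ker0|kerT].
- rewrite !fE => /eqP Au; apply/eqP.
  by rewrite mulmxA -commA // -mulmxA Au scalemxAr.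
- have : v^T \in lker f by rewrite fE -[A]symA -trmx_mul vA linearZ.
  by rewrite ker0 memv0 -[0]trmx0 (inj_eq trmx_inj) (negPf nzv).
(* The eigenspace is everything: evaluate it on the standard basis. *)
apply/matrixP=> i j; have : delta_mx j 0 \in lker f by rewrite kerT memvf.
rewrite fE -colE => /eqP/colP/(_ i); rewrite !mxE eqxx andbT => ->.
by rewrite mulr_natr.
Qed.

End SymmetricSchur.

(** * Passing to the complexification *)

Section Complexification.
Variables (R : realType) (n : nat) (gR : {vspace 'M[R]_n}).
Local Notation C := R[i].
Local Notation toC := (map_mx (real_complex R)).
Let g := complexification gR.

Lemma complexification_ind (K : 'M[C]_n -> Prop) :
  K 0 -> (forall a X Y, K X -> K Y -> K (a *: X + Y)) ->
  (forall X, X \in gR -> K (toC X)) ->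
  forall X, X \in g -> K X.
Proof.
move=> K0 Klin KR; apply: span_lin_ind => // _ /mapP[X /vbasis_mem gX ->].
exact: KR.
Qed.

Lemma mem_complexification X : X \in gR -> toC X \in g.
Proof.
move=> gX; rewrite (coord_vbasis gX) raddf_sum /=.
apply: memv_suml => i _; rewrite map_mxZ memvZ //; apply: memv_span.
by apply: map_f; apply: mem_nth; rewrite size_tuple.
Qed.

Lemma complexification_skew :
  (forall X, X \in gR -> skew_mx X) -> forall X, X \in g -> X^T = - X.
Proof.
move=> skgR; apply: complexification_ind => [|a X Y skX skY|X gX].
- by rewrite trmx0 oppr0.
- by rewrite linearD linearZ /= skX skY opprD scalerN.
by rewrite map_trmx skgR // map_mxN.
Qed.

Lemma complexification_bracket :
  (forall X Y, X \in gR -> Y \in gR -> X *m Y - Y *m X \in gR) ->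
  forall X Y, X \in g -> Y \in g -> X *m Y - Y *m X \in g.
Proof.
move=> brR X Y gX; move: X gX Y.
apply: complexification_ind => [Y _|a X X' IHX IHX' Y gY|X gX].
- by rewrite mul0mx mulmx0 subrr mem0v.
- rewrite mulmxDl mulmxDr opprD addrACA -scalemxAl -scalemxAr -scalerBr.
  by rewrite memvD ?memvZ ?IHX ?IHX'.
apply: complexification_ind => [|a Y Y' IHY IHY'|Y gY].
- by rewrite mul0mx mulmx0 subrr mem0v.
- rewrite mulmxDl mulmxDr opprD addrACA -scalemxAl -scalemxAr -scalerBr.
  by rewrite memvD ?memvZ.
by rewrite -!map_mxM -map_mxB mem_complexification // brR.
Qed.

(** [f] stands for the real or the imaginary part, both of which are linear over
    the reals. *)
Lemma map_mx_real_linear_mul (f : C -> R) (X : 'M[R]_n) (A : 'M[C]_n) :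
  f 0 = 0 -> {morph f : x y / x + y} ->
  (forall a z, f (real_complex R a * z) = a * f z) ->
  map_mx f (toC X *m A) = X *m map_mx f A /\
  map_mx f (A *m toC X) = map_mx f A *m X.
Proof.
move=> f0 fD fZ; split; apply/matrixP=> i j; rewrite !mxE (big_morph f fD f0).
  by apply: eq_bigr => l _; rewrite !mxE fZ.
by apply: eq_bigr => l _; rewrite !mxE mulrC fZ mulrC.
Qed.

(** [g] may act reducibly on the complexification, so the real and imaginary parts
    of [A] are treated separately over the reals. *)
Lemma complex_symmetric_schur (A : 'M[C]_n) :
  irreducible_on (fun X => X \in gR) -> A^T = A ->
  (forall X, X \in g -> X *m A = A *m X) -> exists a, A = a%:M.
Proof.
move=> irr symA commA.
have part (f : C -> R) : f 0 = 0 -> {morph f : x y / x + y} ->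
    (forall a z, f (real_complex R a * z) = a * f z) ->
    exists a, map_mx f A = a%:M.
  move=> f0 fD fZ; apply: (symmetric_schur irr); first by rewrite map_trmx symA.
  move=> X gX; have [fXA fAX] := map_mx_real_linear_mul X A f0 fD fZ.
  by rewrite -fXA -fAX commA // mem_complexification.
have [|||a reA] := part (@complex.Re R); [by []|by case=> ? ? []| |].
  by move=> a [x y] /=; rewrite mul0r subr0.
have [|||b imA] := part (@complex.Im R); [by []|by case=> ? ? []| |].
  by move=> b [x y] /=; rewrite mul0r addr0.
exists (a +i* b)%C; apply/matrixP=> i j.
have := congr1 (fun M : 'M__ => M i j) imA.
have := congr1 (fun M : 'M__ => M i j) reA.
by rewrite !mxE; case: (A i j) (i == j) => x y [] /= -> ->.
Qed.

End Complexification.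

(** * Skewness and brackets in the holonomy list *)

Section HolonomyAlgebras.
Variables (R : realType) (n : nat).
Implicit Types X Y I J : 'M[R]_n.

Lemma skew_bracket X Y : skew_mx X -> skew_mx Y -> skew_mx (X *m Y - Y *m X).
Proof.
rewrite /skew_mx => skX skY; rewrite linearB /= !trmx_mul skX skY.
by rewrite !mulNmx !mulmxN !opprK opprB.
Qed.

Lemma comm_bracket X Y J : X *m J = J *m X -> Y *m J = J *m Y ->
  (X *m Y - Y *m X) *m J = J *m (X *m Y - Y *m X).
Proof.
move=> XJ YJ; rewrite mulmxBl mulmxBr; congr (_ - _).
  by rewrite -mulmxA YJ !mulmxA XJ.
by rewrite -mulmxA XJ !mulmxA YJ.
Qed.

Lemma trace_comm_bracket X Y J : X *m J = J *m X ->
  \tr (J *m (X *m Y - Y *m X)) = 0.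
Proof.
move=> XJ; rewrite mulmxBr raddfB /= [J *m (Y *m X)]mulmxA.
rewrite [\tr (_ *m X)]mxtrace_mulC.
by rewrite !mulmxA XJ subrr.
Qed.

Section Quaternions.
Variables I J : 'M[R]_n.
Hypothesis IJq : quaternionic_structure I J.
Let quat (a b c : R) := a *: I + b *: J + c *: (I *m J).

Lemma quaternion_skew a b c : skew_mx (quat a b c).
Proof.
case: IJq => -[skI _] [skJ _] IJ; rewrite /skew_mx !linearD !linearZ /=.
rewrite trmx_mul skI skJ mulNmx mulmxN opprK -[J *m I]opprK -IJ.
by rewrite !scalerN ?opprD.
Qed.

(** The commutator of quaternions is twice the cross product of their imaginary
    parts. *)
Lemma quaternion_bracket a b c a' b' c' :
  quat a b c *m quat a' b' c' - quat a' b' c' *m quat a b c =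
  quat ((b * c' - c * b') *+ 2) ((c * a' - a * c') *+ 2)
       ((a * b' - b * a') *+ 2).
Proof.
case: IJq => -[_ II] [_ JJ] IJ; rewrite /quat.
have JI : J *m I = - (I *m J) by rewrite IJ opprK.
set K := I *m J in JI *.
have IJK : I *m J = K by [].
have IK : I *m K = - J by rewrite mulmxA II mulNmx mul1mx.
have KJ : K *m J = - I by rewrite -mulmxA JJ mulmxN mulmx1.
have KI : K *m I = J by rewrite -mulmxA JI mulmxN IK opprK.
have JK : J *m K = I by rewrite mulmxA JI mulNmx KJ opprK.
have KK : K *m K = - 1%:M by rewrite {2}/K mulmxA KI JJ.
clearbody K.
rewrite !mulmxDl !mulmxDr -!scalemxAl -!scalemxAr.
rewrite II JJ KK IJK JI IK KI JK KJ.
by apply/matrixP=> i j; rewrite !mxE; ring.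
Qed.

End Quaternions.

Section Clifford.
Variable c : 'I_7 -> 'M[R]_n.
Hypothesis cc : clifford_generators c.
Let spin : {vspace 'M[R]_n} :=
  (\sum_(i < 7) \sum_(j < 7 | (i < j)%N) <[c i *m c j]>)%VS.
Let delta (i j : 'I_7) : R := (i == j)%:R.
(** Adding [delta i j] cancels the square [c i c i = - 1], so that [e i j] lies in
    [spin] for all [i] and [j], including equal ones. *)
Let e i j := c i *m c j + (delta i j)%:M.

Lemma clifford_swap i j : c i *m c j = - (delta i j *+ 2)%:M - c j *m c i.
Proof. by rewrite -(cc.2 i j) addrK. Qed.

Lemma mem_spin i j : e i j \in spin.
Proof.
have lt_mem (a b : 'I_7) : (a < b)%N -> c a *m c b \in spin.
  move=> lt_ab; rewrite memvE; apply: (sumv_sup a) => //.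
  exact: (sumv_sup b).
rewrite /e /delta; have [lt_ij|lt_ji|/val_inj <-] := ltngtP i j.
- by rewrite -val_eqE ltn_eqF // raddf0 addr0 lt_mem.
- rewrite clifford_swap /delta -val_eqE gtn_eqF // mul0rn.
  by rewrite raddf0 addr0 oppr0 add0r memvN lt_mem.
have cc2 := clifford_swap i i; rewrite /delta eqxx in cc2 *.
suff -> : c i *m c i + 1%:M = 0 by rewrite mem0v.
move: (c i *m c i) cc2 => z /matrixP zE; apply/matrixP=> r s.
by have := zE r s; rewrite !mxE; case: (r == s) => /=; lra.
Qed.

Lemma spin_ind (K : 'M[R]_n -> Prop) :
  K 0 -> (forall a X Y, K X -> K Y -> K (a *: X + Y)) ->
  (forall i j, i != j -> K (c i *m c j)) ->
  forall X, X \in spin -> K X.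
Proof.
move=> K0 Klin Kc X.
have KD X1 X2 : K X1 -> K X2 -> K (X1 + X2).
  by move=> K1 K2; rewrite -[X1]scale1r; apply: Klin.
move=> /memv_sumP[f memf ->]; apply: big_rec => // i Y _; apply: (KD).
have /memv_sumP[h memh ->] := memf i isT.
apply: (big_ind K K0 KD) => j lt_ij; have /vlineP[a ->] := memh j lt_ij.
rewrite -[_ *: _]addr0; apply: Klin => //; apply: Kc.
by rewrite -val_eqE ltn_eqF.
Qed.

Lemma spin_skew X : X \in spin -> skew_mx X.
Proof.
move: X; apply: spin_ind => [|a X Y|i j ne_ij]; rewrite /skew_mx.
- by rewrite trmx0 oppr0.
- by move=> skX skY; rewrite linearD linearZ /= skX skY opprD scalerN.
rewrite trmx_mul !cc.1 mulNmx mulmxN opprK.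
rewrite (clifford_swap j i) /delta [j == i]eq_sym.
by rewrite (negPf ne_ij) mul0rn raddf0 oppr0 add0r.
Qed.

(** Moving [c k c l] to the left past [c i c j] takes four transpositions.  The
    scalar corrections hidden in the elements [e] cancel. *)
Lemma clifford_bracket i j k l :
  (c i *m c j) *m (c k *m c l) - (c k *m c l) *m (c i *m c j) =
  (delta j l *+ 2) *: e i k - (delta j k *+ 2) *: e i l
  + (delta i l *+ 2) *: e k j - (delta i k *+ 2) *: e l j.
Proof.
have swap_in (X Y : 'M[R]_n) a b : X *m (c a *m c b) *m Y =
    - (delta a b *+ 2) *: (X *m Y) - X *m (c b *m c a) *m Y.
  rewrite clifford_swap mulmxBr mulmxBl -scalemx1 -scaleNr.
  by rewrite -scalemxAr -scalemxAl mulmx1.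
have deltaC a b : delta a b = delta b a by rewrite /delta eq_sym.
have := swap_in (c i) (c l) j k; have := swap_in (c i *m c k) 1%:M j l.
have := swap_in 1%:M (c l *m c j) i k; have := swap_in (c k) (c j) i l.
rewrite !mulmx1 !mul1mx !mulmxA => -> -> -> ->.
rewrite /e (deltaC k j) (deltaC l j) -![(delta _ _)%:M]scalemx1.
move: (c i *m c l) (c i *m c k) (c l *m c j) (c k *m c j).
move: (c k *m _ *m _ *m _) (1%:M) => *.
by apply/matrixP=> r s; rewrite !mxE; ring.
Qed.

Lemma spin_bracket X Y : X \in spin -> Y \in spin -> X *m Y - Y *m X \in spin.
Proof.
move=> sX; move: X sX Y.
apply: spin_ind => [Y _|a X X' IHX IHX' Y sY|i j _].
- by rewrite mul0mx mulmx0 subrr mem0v.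
- rewrite mulmxDl mulmxDr opprD addrACA -scalemxAl -scalemxAr -scalerBr.
  by rewrite memvD ?memvZ ?IHX ?IHX'.
apply: spin_ind => [|a Y Y' IHY IHY'|k l _].
- by rewrite mul0mx mulmx0 subrr mem0v.
- rewrite mulmxDl mulmxDr opprD addrACA -scalemxAl -scalemxAr -scalerBr.
  by rewrite memvD ?memvZ.
have spe s a b : s *: e a b \in spin by apply/memvZ/mem_spin.
rewrite clifford_bracket; apply: memvB (spe _ _ _).
by apply: memvD (spe _ _ _); apply: memvB.
Qed.

End Clifford.

Lemma holonomy_skew (gR : {vspace 'M[R]_n}) :
  holonomy_list gR -> forall X, X \in gR -> skew_mx X.
Proof.
case=> [gE|J _ gE|J _ gE|I J _ gE|I J IJ gE|L _ _ gE|c _ cc ->] X.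
- by move=> /gE.
- by move=> /gE[].
- by move=> /gE[].
- by move=> /gE[].
- move=> /gE[Y [a [b [c [skY _ _ ->]]]]].
  by rewrite /skew_mx linearD /= skY (quaternion_skew IJ) -opprD.
- by move=> /gE[].
exact: spin_skew.
Qed.

Lemma holonomy_bracket (gR : {vspace 'M[R]_n}) :
  holonomy_list gR ->
  forall X Y, X \in gR -> Y \in gR -> X *m Y - Y *m X \in gR.
Proof.
case=> [gE|J _ gE|J _ gE|I J _ gE|I J IJ gE|L _ _ gE|c _ cc ->] X Y.
- by move=> /gE skX /gE skY; apply/gE/skew_bracket.
- move=> /gE[skX XJ] /gE[skY YJ]; apply/gE.
  by split; [apply: skew_bracket|apply: comm_bracket].
- move=> /gE[skX XJ trX] /gE[skY YJ trY]; apply/gE.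
  split; [exact: skew_bracket|exact: comm_bracket|exact: trace_comm_bracket].
- move=> /gE[skX XI XJ] /gE[skY YI YJ]; apply/gE.
  split; [exact: skew_bracket|exact: comm_bracket|exact: comm_bracket].
- move=> /gE[X1 [a [b [c [skX XI XJ ->]]]]] /gE[Y1 [a' [b' [c' [skY YI YJ ->]]]]].
  apply/gE; exists (X1 *m Y1 - Y1 *m X1).
  exists ((b * c' - c * b') *+ 2), ((c * a' - a * c') *+ 2).
  exists ((a * b' - b * a') *+ 2).
  split; [exact: skew_bracket|exact: comm_bracket|exact: comm_bracket|].
  rewrite -(quaternion_bracket IJ).
  have commq (Z : 'M[R]_n) x y z : Z *m I = I *m Z -> Z *m J = J *m Z ->
      let q := x *: I + y *: J + z *: (I *m J) in Z *m q = q *m Z.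
    move=> ZI ZJ /=; have ZK : Z *m (I *m J) = I *m J *m Z.
      by rewrite mulmxA ZI -mulmxA ZJ mulmxA.
    by rewrite !mulmxDl !mulmxDr -!scalemxAl -!scalemxAr ZI ZJ ZK.
  have /= Xq := commq X1 a' b' c' XI XJ; have /= Yq := commq Y1 a b c YI YJ.
  move: (a *: I + _ + _) (a' *: I + _ + _) Xq Yq => q q' Xq Yq.
  rewrite !mulmxDl !mulmxDr Xq Yq.
  move: (X1 *m Y1) (Y1 *m X1) (q *m Y1) (q' *m X1) (q *m q') (q' *m q) => *.
  by apply/matrixP=> i j; rewrite !mxE; ring.
- move=> /gE[skX Xder] /gE[skY Yder]; apply/gE; split; first exact: skew_bracket.
  move=> x y; rewrite !mulmxBl linearB mulmxBl mulmxBr -!mulmxA.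
  rewrite Xder Yder !mulmxDr !Xder !Yder.
  move: (L (X *m (Y *m x)) *m y) (L (Y *m (X *m x)) *m y).
  move: (L (X *m x) *m (Y *m y)) (L (Y *m x) *m (X *m y)).
  move: (L x *m (X *m _)) (L x *m (Y *m _)) => *.
  by apply/colP=> i; rewrite !mxE; ring.
exact: spin_bracket.
Qed.

End HolonomyAlgebras.

(** * Gram-Schmidt polynomials and the twist *)

Theorem corollary4p3 (R : realType) (n m : nat) (gR : {vspace 'M[R]_n})
    (Xs : seq 'M[R[i]]_n) (rho : 'M[R[i]]_n -> 'M[R[i]]_m)
    (k : nat) (p : nat -> 'M[R[i]]_(n * m)) :
  let g := complexification gR in
  let B := conformal_weight Xs rho in
  holonomy_algebra gR ->
  orthonormal_basis g Xs ->
  irreducible_representation g rho ->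
  gram_schmidt B k p ->
  (forall j, (j <= k)%N -> twist_eigenvector (p j)) ->
  classifying_eigenvector Xs (p k) ->
  exists P : 'M[R[i]]_(n * m),
    unique (orthogonal_projection_compl g rho (powers_span B k) (B ^+ k.+1)) P
    /\ twist_eigenvector P.
Proof.
move=> g B [irr hol] onb [rep _] gs twp Kp.
have skg := complexification_skew (holonomy_skew hol).
have brg := complexification_bracket (holonomy_bracket hol).
have [|X gX|c cas] := complex_symmetric_schur (A := \sum_(X <- Xs) X *m X) irr.
- rewrite linear_sum; apply: eq_big_seq => X /(basis_mem (proj1 onb)) gX /=.
  by rewrite trmx_mul skg // mulNmx mulmxN opprK.
- exact: (casimir_commute onb brg).
(* The constant of the identity is defined by [sum X^2 = - c]. *)
apply: (projection_twist_eigenvector onb brg skg (c := - c) _ rep gs twp Kp).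
by rewrite cas raddfN opprK.
Qed.
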